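(* The entire family of integral triangles $ABC$ with the angle at $B$ equal to twice the angle at $A$ is parametrically described as follows. Let $a,b,c$ be real numbers. There exists an integral triangle $ABC$ with side lengths $|\overline{BC}|=a$, $|\overline{CA}|=b$, $|\overline{AB}|=c$ and $\angle B = 2\angle A$ if and only if there exist positive integers $\ell, k, m$ such that $$a=\ell k^2,\qquad b=\ell k m,\qquad c=\ell(m^2-k^2),$$ where $k$ and $m$ are relatively prime and either $k^2<m^2<2k^2$ or $2k^2<m^2<4k^2$.
   Context: Triangles are non-degenerate triangles in the Euclidean plane. An integral triangle is a triangle all three of whose side lengths are integers. For a triangle $ABC$, $\angle A$ and $\angle B$ denote the interior angles at the vertices $A$ and $B$. *)

(* Defs.v *)
From Stdlib Require Import Reals ZArith.
Open Scope R_scope.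

Definition point : Type := (R * R)%type.

Definition plane_dist (P Q : point) : R := dist_euc (fst P) (snd P) (fst Q) (snd Q).

(* The vectors AB and AC are linearly independent. *)
Definition is_triangle (A B C : point) : Prop :=
  (fst B - fst A) * (snd C - snd A) - (fst C - fst A) * (snd B - snd A) <> 0.

Definition is_integer (x : R) : Prop := exists z : Z, x = IZR z.

Definition integral_triangle (A B C : point) : Prop :=
  is_triangle A B C /\
  is_integer (plane_dist B C) /\ is_integer (plane_dist C A) /\ is_integer (plane_dist A B).

(* Unoriented angle at the vertex Q between the rays QP and QS, in [0, PI];
   meaningful only when P <> Q and S <> Q, which holds at every vertex of a
   non-degenerate triangle. *)
Definition angle (P Q S : point) : R :=
  acos (((fst P - fst Q) * (fst S - fst Q) + (snd P - snd Q) * (snd S - snd Q))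
        / (plane_dist Q P * plane_dist Q S)).

(* Main.v *)
Require Import Defs.
From Stdlib Require Import Reals ZArith Znumtheory Lra Lia.
Open Scope R_scope.

(** By the double angle formula and the law of cosines, [B = 2 A] reads
    [(b^2 - a (a + c)) (b^2 - (c - a)^2) = 0], and the second factor cannot vanish
    in a non-degenerate triangle; so the condition is [b^2 = a (a + c)].  Over the
    integers, write [a = g k] and [b = g m] with [k], [m] coprime: then
    [g m^2 = k (a + c)] forces [k] to divide [g], and [l = g / k].  The remaining
    inequality [c < a + b] amounts to [m < 2 k], and [m^2 = 2 k^2] is impossible. *)

(** * Heron's expression and triangles with prescribed sides *)

(* Sixteen times the squared area, by Heron's formula. *)
Definition heron (a b c : R) : R := 4 * b ^ 2 * c ^ 2 - (b ^ 2 + c ^ 2 - a ^ 2) ^ 2.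

Lemma heron_factor (a b c : R) :
  heron a b c = (a + b + c) * (b + c - a) * (a + b - c) * (a + c - b).
Proof. unfold heron; ring. Qed.

Lemma heron_swap (a b c : R) : heron a b c = heron b a c.
Proof. unfold heron; ring. Qed.

Lemma plane_dist_sq (P Q : point) :
  plane_dist P Q ^ 2 = (fst P - fst Q) ^ 2 + (snd P - snd Q) ^ 2.
Proof.
  unfold plane_dist, dist_euc.
  rewrite <- Rsqr_pow2, Rsqr_sqrt.
  - unfold Rsqr; ring.
  - apply Rplus_le_le_0_compat; apply Rle_0_sqr.
Qed.

Lemma plane_dist_nonneg (P Q : point) : 0 <= plane_dist P Q.
Proof. apply sqrt_pos. Qed.

Lemma plane_dist_sym (P Q : point) : plane_dist P Q = plane_dist Q P.
Proof. apply distance_symm. Qed.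

Lemma plane_dist_unique (P Q : point) (d : R) :
  0 <= d -> (fst P - fst Q) ^ 2 + (snd P - snd Q) ^ 2 = d ^ 2 -> plane_dist P Q = d.
Proof.
  intros Hd H; rewrite <- plane_dist_sq in H.
  pose proof (plane_dist_nonneg P Q); nra.
Qed.

(** Polarization turns the dot product into squared distances, which removes the coordinates from
    the angle condition. *)
Lemma angle_law_of_cosines (P Q S : point) :
  angle P Q S =
  acos ((plane_dist Q P ^ 2 + plane_dist Q S ^ 2 - plane_dist P S ^ 2)
        / (2 * plane_dist Q P * plane_dist Q S)).
Proof.
  unfold angle; f_equal.
  replace ((fst P - fst Q) * (fst S - fst Q) + (snd P - snd Q) * (snd S - snd Q))
    with ((plane_dist Q P ^ 2 + plane_dist Q S ^ 2 - plane_dist P S ^ 2) / 2)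
    by (rewrite !plane_dist_sq; field).
  unfold Rdiv; rewrite !Rinv_mult; ring.
Qed.

(** Lagrange's identity for the vectors AB and AC: the product of their squared lengths minus the
    squared dot product is the squared determinant. *)
Lemma heron_triangle (A B C : point) :
  heron (plane_dist B C) (plane_dist C A) (plane_dist A B) =
  4 * ((fst B - fst A) * (snd C - snd A) - (fst C - fst A) * (snd B - snd A)) ^ 2.
Proof. unfold heron; rewrite !plane_dist_sq; ring. Qed.

Lemma triangle_sides (A B C : point) :
  is_triangle A B C ->
  0 < plane_dist B C /\ 0 < plane_dist C A /\ 0 < plane_dist A B /\
  0 < heron (plane_dist B C) (plane_dist C A) (plane_dist A B).
Proof.
  intros H.
  assert (Hh : 0 < heron (plane_dist B C) (plane_dist C A) (plane_dist A B)).
  { rewrite heron_triangle. pose proof (Rlt_0_sqr _ H) as Hd; rewrite Rsqr_pow2 in Hd; lra. }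
  assert (Hpos : forall P Q, plane_dist P Q <> 0 -> 0 < plane_dist P Q).
  { intros P Q HPQ; pose proof (plane_dist_nonneg P Q); lra. }
  unfold heron in *; revert Hh.
  generalize (Hpos B C) (Hpos C A) (Hpos A B).
  generalize (plane_dist B C) (plane_dist C A) (plane_dist A B).
  intros a b c Ha Hb Hc Hh; repeat split; try exact Hh.
  (* When one side is zero, [heron] is minus a square, for instance [- (b ^ 2 - c ^ 2) ^ 2] for
     [a = 0], against [Hh]. *)
  - apply Ha; intros ->; pose proof (pow2_ge_0 (b ^ 2 - c ^ 2)); lra.
  - apply Hb; intros ->; pose proof (pow2_ge_0 (c ^ 2 - a ^ 2)); lra.
  - apply Hc; intros ->; pose proof (pow2_ge_0 (b ^ 2 - a ^ 2)); lra.
Qed.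

Lemma triangle_of_sides (a b c : R) :
  0 < a -> 0 < b -> 0 < c -> 0 < heron a b c ->
  exists A B C : point,
    is_triangle A B C /\ plane_dist B C = a /\ plane_dist C A = b /\ plane_dist A B = c.
Proof.
  intros Ha Hb Hc Hh.
  (* With A at the origin and B at [(c, 0)], [x] is the abscissa of C and [q] the square of the
     altitude from C. *)
  set (x := (b ^ 2 + c ^ 2 - a ^ 2) / (2 * c)).
  set (q := heron a b c / (4 * c ^ 2)).
  assert (Hq : 0 < q).
  { apply Rdiv_lt_0_compat; [exact Hh | nra]. }
  assert (Hs : sqrt q ^ 2 = q) by (apply pow2_sqrt; lra).
  pose proof (sqrt_lt_R0 q Hq) as Hs0.
  exists (0, 0), (c, 0), (x, sqrt q); repeat split.
  - unfold is_triangle; simpl; nra.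
  - apply plane_dist_unique; [lra|]; simpl fst; simpl snd.
    replace ((0 - sqrt q) ^ 2) with (sqrt q ^ 2) by ring.
    rewrite Hs; unfold q, x, heron; field; lra.
  - apply plane_dist_unique; [lra|]; simpl fst; simpl snd.
    replace ((sqrt q - 0) ^ 2) with (sqrt q ^ 2) by ring.
    rewrite Hs; unfold q, x, heron; field; lra.
  - apply plane_dist_unique; [lra|]; simpl fst; simpl snd; ring.
Qed.

(** * The angle condition as an equation between sides *)

(** If [t] is the quotient, then [heron a b c = (2 * c * b) ^ 2 * (1 - t ^ 2)]. The bound is what
    allows [cos_acos] to be applied. *)
Lemma cosine_bound (a b c : R) :
  0 < b -> 0 < c -> 0 < heron a b c ->
  -1 <= (b ^ 2 + c ^ 2 - a ^ 2) / (2 * c * b) <= 1.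
Proof.
  intros Hb Hc Hh.
  assert (Hbc : 0 < 2 * c * b) by nra.
  assert (E : b ^ 2 + c ^ 2 - a ^ 2
              = (b ^ 2 + c ^ 2 - a ^ 2) / (2 * c * b) * (2 * c * b)) by (field; lra).
  unfold heron in Hh; rewrite E in Hh.
  revert Hh; generalize ((b ^ 2 + c ^ 2 - a ^ 2) / (2 * c * b)); intros t Ht.
  assert (0 < (2 * c * b) ^ 2 * (1 - t ^ 2)) by nra.
  assert (0 < 1 - t ^ 2) by (apply (Rmult_lt_reg_l ((2 * c * b) ^ 2)); nra).
  nra.
Qed.

Lemma double_angle_sides (a b c : R) :
  0 < a -> 0 < b -> 0 < c -> 0 < heron a b c ->
  acos ((c ^ 2 + a ^ 2 - b ^ 2) / (2 * c * a))
    = 2 * acos ((c ^ 2 + b ^ 2 - a ^ 2) / (2 * c * b))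
  <-> b ^ 2 = a * (a + c).
Proof.
  intros Ha Hb Hc Hh.
  pose proof (cosine_bound a b c Hb Hc Hh) as HA.
  pose proof Hh as Hh'; rewrite heron_swap in Hh'.
  pose proof (cosine_bound b a c Ha Hc Hh') as HB.
  rewrite (Rplus_comm (b ^ 2)) in HA; rewrite (Rplus_comm (a ^ 2)) in HB.
  rewrite heron_factor in Hh.
  split; intros H.
  - apply (f_equal cos) in H.
    rewrite cos_2a_cos, !cos_acos in H by assumption.
    (* Clearing denominators in [2 * v * v - 1 - u = 0] gives this product times [a + c], which is
       positive and cancels. *)
    assert (E : (b ^ 2 - a * (a + c)) * (b ^ 2 - (c - a) ^ 2) = 0).
    { set (u := (c ^ 2 + a ^ 2 - b ^ 2) / (2 * c * a)) in *.
      set (v := (c ^ 2 + b ^ 2 - a ^ 2) / (2 * c * b)) in *.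
      assert (Z0 : (2 * v * v - 1 - u) * (2 * a * b ^ 2 * c ^ 2) = 0)
        by (rewrite H; ring).
      apply (Rmult_eq_reg_l (a + c)); [| lra].
      rewrite Rmult_0_r, <- Z0; unfold u, v; field; lra. }
    apply Rmult_integral in E; destruct E as [E | E]; [lra|].
    (* The vanishing factor is [(b + c - a) * (a + b - c)], two of the four factors of [heron]. *)
    replace ((a + b + c) * (b + c - a) * (a + b - c) * (a + c - b))
      with ((b ^ 2 - (c - a) ^ 2) * ((a + b + c) * (a + c - b))) in Hh by ring.
    rewrite E in Hh; lra.
  (* Substituting for [b ^ 2] makes the cosine at A equal to [(a + c) / (2 * b)], and the cosine at
     B its double-angle value. *)
  - assert (EA : (c ^ 2 + b ^ 2 - a ^ 2) / (2 * c * b) = (a + c) / (2 * b))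
      by (rewrite H; field; lra).
    assert (EB : (c ^ 2 + a ^ 2 - b ^ 2) / (2 * c * a)
                 = 2 * ((a + c) / (2 * b)) * ((a + c) / (2 * b)) - 1).
    { replace (2 * ((a + c) / (2 * b)) * ((a + c) / (2 * b)))
        with ((a + c) ^ 2 / (2 * b ^ 2)) by (field; lra).
      rewrite H; field; lra. }
    rewrite EA in *; rewrite EB.
    assert (Hv : 0 < (a + c) / (2 * b)) by (apply Rdiv_lt_0_compat; lra).
    revert HA Hv; generalize ((a + c) / (2 * b)); intros v HA Hv.
    replace (2 * v * v - 1) with (cos (2 * acos v))
      by (rewrite cos_2a_cos, !cos_acos by lra; reflexivity).
    (* Equal cosines give equal angles only if [2 * acos v] lies in [[0, PI]]; this holds because
       [v > 0] makes the angle at A acute. *)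
    apply acos_cos.
    pose proof (acos_bound v).
    assert (acos v < PI / 2); [| lra].
    apply cos_decreasing_0; try (pose proof PI_RGT_0; lra).
    rewrite cos_PI2, cos_acos; lra.
Qed.

(** The equation gives [a ^ 2 < b ^ 2 < (a + c) ^ 2], so two of the triangle inequalities are
    automatic and only the third remains. *)
Lemma heron_pos_double_angle (a b c : R) :
  0 < a -> 0 < b -> 0 < c -> b ^ 2 = a * (a + c) -> (0 < heron a b c <-> c < a + b).
Proof.
  intros Ha Hb Hc H.
  assert (H1 : 0 < b + c - a) by nra.
  assert (H2 : 0 < a + c - b) by nra.
  rewrite heron_factor; split; intros K.
  - assert (0 < (a + b + c) * (b + c - a) * (a + c - b))
      by (repeat apply Rmult_lt_0_compat; lra).
    apply Rnot_le_lt; intros Hle; nra.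
  - repeat apply Rmult_lt_0_compat; lra.
Qed.

(** Both directions of the final result pass through this criterion over the reals; what is left
    afterwards is arithmetic. *)
Theorem double_angle_triangle (a b c : R) :
  (exists A B C : point,
      is_triangle A B C /\
      plane_dist B C = a /\ plane_dist C A = b /\ plane_dist A B = c /\
      angle A B C = 2 * angle B A C)
  <-> 0 < a /\ 0 < b /\ 0 < c /\ b ^ 2 = a * (a + c) /\ c < a + b.
Proof.
  split.
  - intros (A & B & C & HT & <- & <- & <- & Hang).
    destruct (triangle_sides A B C HT) as (Ha & Hb & Hc & Hh).
    rewrite !angle_law_of_cosines in Hang.
    rewrite (plane_dist_sym B A), (plane_dist_sym A C) in Hang.
    apply double_angle_sides in Hang; [| assumption ..].
    repeat split; try assumption.
    apply heron_pos_double_angle; assumption.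
  - intros (Ha & Hb & Hc & H & Hlt).
    assert (Hh : 0 < heron a b c) by (apply heron_pos_double_angle; assumption).
    destruct (triangle_of_sides a b c Ha Hb Hc Hh) as (A & B & C & HT & Ea & Eb & Ec).
    exists A, B, C; repeat split; try assumption.
    rewrite !angle_law_of_cosines, (plane_dist_sym B A), (plane_dist_sym A C), Ea, Eb, Ec.
    apply double_angle_sides; assumption.
Qed.

(** * Integer solutions of the equation *)

(** Equality would make [k] divide [m * m], so coprimality forces [k = 1], and 2 is not a square. *)
Lemma square_neq_double_square (k m : Z) :
  (0 < k)%Z -> rel_prime k m -> (m ^ 2 <> 2 * k ^ 2)%Z.
Proof.
  intros Hk Hp E.
  assert (Hd : (k | m * m)%Z) by (exists (2 * k)%Z; lia).
  apply Gauss in Hd; [| exact Hp].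
  assert (Hd1 : (k | 1)%Z).
  { destruct Hp as [_ _ Hg]; apply Hg; [exists 1%Z; ring | exact Hd]. }
  apply Z.divide_1_r_nonneg in Hd1; [subst k | lia].
  assert (m <= -2 \/ m = -1 \/ m = 0 \/ m = 1 \/ 2 <= m)%Z as Hm by lia.
  destruct Hm as [Hm | [-> | [-> | [-> | Hm]]]]; nia.
Qed.

Lemma double_angle_parametrization (a b c : Z) :
  (0 < a)%Z -> (0 < b)%Z -> (b ^ 2 = a * (a + c))%Z ->
  exists l k m : Z,
    (0 < l)%Z /\ (0 < k)%Z /\ (0 < m)%Z /\
    a = (l * k ^ 2)%Z /\ b = (l * k * m)%Z /\ c = (l * (m ^ 2 - k ^ 2))%Z /\
    rel_prime k m.
Proof.
  intros Ha Hb H.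
  set (g := Z.gcd a b).
  destruct (Z.gcd_divide_l a b) as [k Ek], (Z.gcd_divide_r a b) as [m Em].
  fold g in Ek, Em.
  assert (Hg : (0 < g)%Z).
  { pose proof (Z.gcd_nonneg a b); assert (g <> 0)%Z by (intros E; rewrite E in Ek; lia); unfold g in *; lia. }
  assert (Hk : (0 < k)%Z) by nia.
  assert (Hm : (0 < m)%Z) by nia.
  assert (Hp : rel_prime k m).
  { apply Zgcd_1_rel_prime.
    assert (Hgg : (Z.gcd (k * g) (m * g) = Z.gcd k m * g)%Z)
      by (apply Z.gcd_mul_mono_r_nonneg; lia).
    rewrite <- Ek, <- Em in Hgg; fold g in Hgg; nia. }
  assert (E : (g * (m * m) = k * (a + c))%Z).
  { apply (Z.mul_reg_l _ _ g); [lia|]. nia. }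
  assert (Hd : (k | m * (m * g))%Z) by (exists (a + c)%Z; nia).
  apply Gauss in Hd; [| exact Hp].
  apply Gauss in Hd; [| exact Hp].
  destruct Hd as [l El].
  exists l, k, m.
  assert (Hl : (0 < l)%Z) by nia.
  assert (Ea : (a = l * k ^ 2)%Z) by (rewrite Ek, El; ring).
  assert (Eb : (b = l * k * m)%Z) by (rewrite Em, El; ring).
  repeat split; try assumption; try apply Hp.
  (* With [g = l * k], cancelling [k] in [E] leaves [l * m ^ 2 = a + c]. *)
  apply (Z.mul_reg_l _ _ k); [lia|].
  rewrite El in E; nia.
Qed.

Theorem mainTheorem1 (a b c : R) :
  (exists A B C : point,
      integral_triangle A B C /\
      plane_dist B C = a /\ plane_dist C A = b /\ plane_dist A B = c /\
      angle A B C = 2 * angle B A C)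
  <->
  (exists l k m : Z,
      (0 < l)%Z /\ (0 < k)%Z /\ (0 < m)%Z /\
      a = IZR (l * k ^ 2) /\
      b = IZR (l * k * m) /\
      c = IZR (l * (m ^ 2 - k ^ 2)) /\
      rel_prime k m /\
      ((k ^ 2 < m ^ 2 < 2 * k ^ 2)%Z \/ (2 * k ^ 2 < m ^ 2 < 4 * k ^ 2)%Z)).
Proof.
  split.
  - intros (A & B & C & (HT & Ia & Ib & Ic) & Ea & Eb & Ec & Hang).
    assert (HD : 0 < a /\ 0 < b /\ 0 < c /\ b ^ 2 = a * (a + c) /\ c < a + b)
      by (apply double_angle_triangle; exists A, B, C; repeat split; assumption).
    rewrite Ea in Ia; rewrite Eb in Ib; rewrite Ec in Ic.
    clear A B C HT Ea Eb Ec Hang.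
    destruct Ia as [a' ->], Ib as [b' ->], Ic as [c' ->].
    destruct HD as (Ha & Hb & Hc & H & Hlt).
    apply lt_IZR in Ha, Hb, Hc.
    rewrite <- plus_IZR in H, Hlt; apply lt_IZR in Hlt.
    rewrite <- mult_IZR, pow_IZR in H; apply eq_IZR in H.
    destruct (double_angle_parametrization a' b' c' Ha Hb H)
      as (l & k & m & Hl & Hk & Hm & -> & -> & -> & Hp).
    exists l, k, m; repeat (split; [first [assumption | reflexivity] |]).
    pose proof (square_neq_double_square k m Hk Hp) as Hne.
    assert (H1 : (k ^ 2 < m ^ 2)%Z) by nia.
    (* In these parameters [a + b - c] factors as [l * (m + k) * (2 * k - m)]. *)
    assert (H2 : (0 < l * ((m + k) * (2 * k - m)))%Z) by nia.
    assert (H3 : (0 < (m + k) * (2 * k - m))%Z) by nia.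
    assert (H4 : (m < 2 * k)%Z) by nia.
    assert (H5 : (m ^ 2 < 4 * k ^ 2)%Z) by nia.
    lia.
  - intros (l & k & m & Hl & Hk & Hm & -> & -> & -> & Hp & Hr).
    assert (H1 : (k ^ 2 < m ^ 2 < 4 * k ^ 2)%Z) by nia.
    assert (H4 : (m < 2 * k)%Z) by nia.
    assert (H3 : (0 < (m + k) * (2 * k - m))%Z) by nia.
    destruct (proj2 (double_angle_triangle (IZR (l * k ^ 2)) (IZR (l * k * m))
                       (IZR (l * (m ^ 2 - k ^ 2)))))
      as (A & B & C & HT & Ea & Eb & Ec & Hang).
    + repeat split.
      * apply IZR_lt; nia.
      * apply IZR_lt; nia.
      * apply IZR_lt; nia.
      * rewrite <- plus_IZR, <- mult_IZR, pow_IZR; f_equal; simpl Z.of_nat; ring.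
      * rewrite <- plus_IZR; apply IZR_lt; nia.
    + exists A, B, C; repeat split; try assumption; eexists; eassumption.
Qed.
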